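(* Let $n,m,d$ be nonnegative integers with $d\ge1$, let $\|\cdot\|$ be a norm on $\mathbb{R}^d$, let $\mathbf{p}_0,\dots,\mathbf{p}_n\in\mathbb{R}^d$ and $\mathbf{q}_0,\dots,\mathbf{q}_m\in\mathbb{R}^d$, and let $\omega_0,\dots,\omega_n>0$. Let $$\mathbf{x}(t)=\frac{\sum_{i=0}^n\omega_i\mathbf{p}_iB_i^n(t)}{\sum_{i=0}^n\omega_iB_i^n(t)}$$ be the corresponding rational Bézier curve of degree $n$ and let $\mathbf{y}(t)=\sum_{j=0}^m\mathbf{q}_jB_j^m(t)$ be the corresponding Bézier curve of degree $m$. Then for every $t\in[0,1]$, $$\|\mathbf{x}(t)-\mathbf{y}(t)\|\le\max_{0\le i\le m+n}\frac{\sum_{j=\max(0,i-m)}^{\min(n,i)}\binom{n}{j}\binom{m}{i-j}\,\omega_j\,\|\mathbf{p}_j-\mathbf{q}_{i-j}\|}{\sum_{j=\max(0,i-m)}^{\min(n,i)}\binom{n}{j}\binom{m}{i-j}\,\omega_j}.$$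
   Context: $B_i^n(t)=\binom{n}{i}t^i(1-t)^{n-i}$ are the Bernstein basis functions. *)

(* Defs.v *)
From HB Require Import structures.
From mathcomp Require Import all_boot all_order all_algebra.
From mathcomp Require Import reals.

Set Implicit Arguments.
Unset Strict Implicit.
Unset Printing Implicit Defensive.

Import Order.TTheory GRing.Theory Num.Theory.
Local Open Scope ring_scope.

(* 'rV[R]_d carries a canonical norm (the sup norm), so an arbitrary norm is a
   function satisfying this predicate rather than an instance. *)
Definition is_norm (R : realType) (d : nat) (N : 'rV[R]_d -> R) : Prop :=
  [/\ forall x, 0 <= N x,
      forall x, N x = 0 -> x = 0,
      forall (a : R) x, N (a *: x) = `|a| * N x
    & forall x y, N (x + y) <= N x + N y].

Definition bernstein (R : realType) (n i : nat) (t : R) : R :=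
  'C(n, i)%:R * t ^+ i * (1 - t) ^+ (n - i).

Definition bezier (R : realType) (d m : nat) (q : 'I_m.+1 -> 'rV[R]_d)
    (t : R) : 'rV[R]_d :=
  \sum_(j < m.+1) bernstein m j t *: q j.

Definition rational_bezier (R : realType) (d n : nat) (w : 'I_n.+1 -> R)
    (p : 'I_n.+1 -> 'rV[R]_d) (t : R) : 'rV[R]_d :=
  (\sum_(i < n.+1) w i * bernstein n i t)^-1 *:
    \sum_(i < n.+1) (w i * bernstein n i t) *: p i.

(* The lower bound i - m is truncated, i.e. it is max(0, i - m).  Under the
   range condition i - j <= m, so inord (i - j) is the index i - j itself. *)
Definition bound_num (R : realType) (d n m : nat) (N : 'rV[R]_d -> R)
    (w : 'I_n.+1 -> R) (p : 'I_n.+1 -> 'rV[R]_d) (q : 'I_m.+1 -> 'rV[R]_d)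
    (i : nat) : R :=
  \sum_(j < n.+1 | (i - m <= j <= minn n i)%N)
    'C(n, j)%:R * 'C(m, i - j)%:R * w j * N (p j - q (inord (i - j))).

Definition bound_den (R : realType) (n m : nat) (w : 'I_n.+1 -> R)
    (i : nat) : R :=
  \sum_(j < n.+1 | (i - m <= j <= minn n i)%N)
    'C(n, j)%:R * 'C(m, i - j)%:R * w j.

(* Maximum of the k.+1 values F 0, ..., F k; taking F 0 as the default value
   keeps it from adding anything to the family. *)
Definition max_upto (R : realType) (k : nat) (F : nat -> R) : R :=
  \big[Num.max/F 0%N]_(i < k.+1) F i.

(* Main.v *)
Require Import Defs.
From HB Require Import structures.
From mathcomp Require Import all_boot all_order all_algebra.
From mathcomp Require Import reals.
From mathcomp Require Import zify ring.

Set Implicit Arguments.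
Unset Strict Implicit.
Unset Printing Implicit Defensive.

Import Order.TTheory GRing.Theory Num.Theory.
Local Open Scope ring_scope.

(* With nonnegative weights w_j B_j^n(t) B_k^m(t), the difference x(t) - y(t) is
   a weighted mean of the p_j - q_k, because the B_k^m(t) sum to 1.  On the
   antidiagonal j + k = i the weights are t^i (1 - t)^(m + n - i) times
   'C(n, j) 'C(m, i - j) w_j, so its contribution to the weighted mean of the
   norms is at most the i-th quotient times its contribution to the total
   weight. *)

(** For fixed [j], the map from [k] to [j + k] is a bijection onto the indices [i] whose range
    condition admits [j], with inverse [i - j]. *)
Lemma sum_antidiagonal (V : nmodType) (n m : nat)
    (F : 'I_n.+1 -> 'I_m.+1 -> V) :
  \sum_j \sum_k F j k =
  \sum_(i < (m + n).+1) \sum_(j < n.+1 | (i - m <= j <= minn n i)%N)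
    F j (inord (i - j)).
Proof.
rewrite [RHS](exchange_big_dep xpredT) //=; apply: eq_bigr => j _.
rewrite (reindex_onto (fun k : 'I_m.+1 => inord (j + k) : 'I_(m + n).+1)
                      (fun i => inord (i - j))) /=; last first.
  move=> i /andP[le_ij le_ji]; apply/val_inj.
  by rewrite /= inordK inordK; have := ltn_ord i; lia.
have jkK (k : 'I_m.+1) : (inord (j + k) : 'I_(m + n).+1) = (j + k)%N :> nat.
  by rewrite inordK //; have := ltn_ord j; have := ltn_ord k; lia.
apply: eq_big => k; last by rewrite jkK addKn inord_val.
rewrite jkK addKn inord_val eqxx andbT; apply/esym.
by have := ltn_ord j; have := ltn_ord k; lia.
Qed.

Section Bernstein.

Variables (R : realType) (t : R).

(** Binomial expansion of [((1 - t) + t) ^+ m]. *)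
Lemma sum_bernstein (m : nat) : \sum_(k < m.+1) bernstein m k t = 1.
Proof.
rewrite -[RHS](expr1n _ m) -[in RHS](subrK t 1) exprDn.
apply: eq_bigr => k _; rewrite -[RHS]mulr_natl /bernstein -mulrA.
by rewrite [t ^+ k * _]mulrC.
Qed.

Lemma mul_bernstein (n m j k : nat) : (j <= n)%N -> (k <= m)%N ->
  bernstein n j t * bernstein m k t =
  t ^+ (j + k) * (1 - t) ^+ (m + n - (j + k)) * ('C(n, j)%:R * 'C(m, k)%:R).
Proof.
move=> le_jn le_km; rewrite /bernstein.
have -> : (m + n - (j + k) = (n - j) + (m - k))%N by lia.
by rewrite !exprD; ring.
Qed.

Hypothesis t01 : 0 <= t <= 1.

Lemma bernstein_ge0 (n i : nat) : 0 <= bernstein n i t.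
Proof.
have /andP[t0 t1] := t01.
by rewrite !mulr_ge0 ?exprn_ge0 ?subr_ge0.
Qed.

(** A vanishing sum of nonnegative terms would force every [bernstein n i t] to be 0, although they
    sum to 1. This treats the endpoints, where single terms do vanish, like any other [t]. *)
Lemma sum_wbernstein_gt0 (n : nat) (w : 'I_n.+1 -> R) :
  (forall i, 0 < w i) -> 0 < \sum_i w i * bernstein n i t.
Proof.
move=> w0; have wB0 i : 0 <= w i * bernstein n i t.
  by rewrite mulr_ge0 ?bernstein_ge0 ?ltW.
rewrite lt0r sumr_ge0 // andbT; apply/eqP => /psumr_eq0P sum0.
have /eqP := sum_bernstein n; rewrite big1 ?(eq_sym 0) ?oner_eq0 // => i _.
have /eqP := sum0 (fun i _ => wB0 i) i isT.
by rewrite mulf_eq0 gt_eqF //= => /eqP.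
Qed.

End Bernstein.

Lemma norm_sum (R : realType) (d : nat) (N : 'rV[R]_d -> R) (I : finType)
    (c : I -> R) (v : I -> 'rV[R]_d) :
  is_norm N -> (forall i, 0 <= c i) ->
  N (\sum_i c i *: v i) <= \sum_i c i * N (v i).
Proof.
case=> _ _ NZ ND c0.
elim/big_ind2: _ => [|x a y b le_xa le_yb|i _].
(* The empty sum needs [N 0 = 0], which is homogeneity with scalar 0. *)
- by rewrite -(scale0r (0 : 'rV[R]_d)) NZ normr0 mul0r.
- exact: le_trans (ND _ _) (lerD le_xa le_yb).
- by rewrite NZ ger0_norm.
Qed.

Lemma rational_bezier_sub (R : realType) (n m d : nat) (w : 'I_n.+1 -> R)
    (p : 'I_n.+1 -> 'rV[R]_d) (q : 'I_m.+1 -> 'rV[R]_d) (t : R) :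
  let W := \sum_i w i * bernstein n i t in W != 0 ->
  rational_bezier w p t - bezier q t =
  W^-1 *: \sum_(jk : 'I_n.+1 * 'I_m.+1)
    (w jk.1 * (bernstein n jk.1 t * bernstein m jk.2 t)) *: (p jk.1 - q jk.2).
Proof.
move=> W W0; rewrite /rational_bezier -/W.
(* Writing [bezier q t] as [W^-1 *: (W *: bezier q t)] gives both curves the factor [W^-1]; the
   numerators are then compared for each [j]. *)
rewrite -[bezier q t](scalerK W0) -scalerBr; congr (_ *: _).
rewrite -(pair_bigA _ (fun (j : 'I_n.+1) (k : 'I_m.+1) =>
  (w j * (bernstein n j t * bernstein m k t)) *: (p j - q k))) /=.
rewrite /W scaler_suml -sumrB; apply: eq_bigr => j _.
under [RHS]eq_bigr => k _ do rewrite scalerBr mulrA -[X in _ - X]scalerA.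
rewrite sumrB -scaler_suml -scaler_sumr -mulr_sumr.
by rewrite sum_bernstein mulr1.
Qed.

Lemma bound_den_gt0 (R : realType) (n m i : nat) (w : 'I_n.+1 -> R) :
  (forall j, 0 < w j) -> (i <= m + n)%N -> 0 < bound_den m w i.
Proof.
(* The witness [j = minn n i] lies in the range because [i <= m + n], and it satisfies [i - j <= m],
   so both binomials are positive there. *)
move=> w0 le_i; have lt_j : (minn n i < n.+1)%N by lia.
rewrite /bound_den (bigD1 (Ordinal lt_j)) /=; last by lia.
apply: ltr_pwDl; first by rewrite !mulr_gt0 ?ltr0n ?bin_gt0 //; lia.
by apply: sumr_ge0 => j _; rewrite !mulr_ge0 // ltW.
Qed.

Theorem theorem2 (R : realType) (n m d : nat) (hd : (1 <= d)%N)
    (N : 'rV[R]_d -> R) (hN : is_norm N)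
    (p : 'I_n.+1 -> 'rV[R]_d) (q : 'I_m.+1 -> 'rV[R]_d)
    (w : 'I_n.+1 -> R) (hw : forall i, 0 < w i)
    (t : R) (ht : 0 <= t <= 1) :
  N (rational_bezier w p t - bezier q t) <=
    max_upto (m + n) (fun i => bound_num N w p q i / bound_den m w i).
Proof.
set M := max_upto _ _.
have W0 := sum_wbernstein_gt0 ht hw; set W := \sum_i _ in W0.
have NZ : forall a x, N (a *: x) = `|a| * N x by case: hN.
rewrite rational_bezier_sub ?gt_eqF // -/W NZ gtr0_norm ?invr_gt0 //.
rewrite [leLHS]mulrC ler_pdivrMr //.
apply: le_trans (norm_sum _ hN _) _ => [jk|].
  by rewrite mulr_ge0 ?(ltW (hw _)) // mulr_ge0 ?bernstein_ge0.
(* Stated for arbitrary [G] because it is used twice: with the norms [N (p j - q k)], and with the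
   constant [M]. *)
have antidiag (G : 'I_n.+1 -> 'I_m.+1 -> R) :
    \sum_j \sum_(k < m.+1) w j * (bernstein n j t * bernstein m k t) * G j k =
    \sum_(i < (m + n).+1) t ^+ i * (1 - t) ^+ (m + n - i) *
      \sum_(j < n.+1 | (i - m <= j <= minn n i)%N)
        'C(n, j)%:R * 'C(m, i - j)%:R * w j * G j (inord (i - j)).
  rewrite sum_antidiagonal; apply: eq_bigr => i _.
  rewrite mulr_sumr; apply: eq_bigr => j /andP[le_ij le_ji].
  rewrite inordK; last by lia.
  rewrite mul_bernstein; [|by lia..].
  rewrite subnKC; last by lia.
  by rewrite [w j * _]mulrC -!mulrA.
rewrite -(pair_bigA _ (fun (j : 'I_n.+1) (k : 'I_m.+1) =>
  w j * (bernstein n j t * bernstein m k t) * N (p j - q k))) /= antidiag.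
(* Spreading [M * W] over the pairs gives both sides the same powers of [t] and [1 - t] on each
   antidiagonal, so they can be compared for each [i]. *)
have -> : M * W = \sum_j \sum_(k < m.+1) w j * (bernstein n j t * bernstein m k t) * M.
  rewrite mulrC mulr_suml; apply: eq_bigr => j _.
  by rewrite -mulr_suml -mulr_sumr -mulr_sumr sum_bernstein mulr1.
rewrite antidiag; apply: ler_sum => i _.
have /andP[t0 t1] := ht.
apply: ler_wpM2l; first by rewrite mulr_ge0 ?exprn_ge0 ?subr_ge0.
rewrite -mulr_suml -/(bound_num N w p q i) -/(bound_den m w i).
rewrite [leRHS]mulrC -ler_pdivrMr ?bound_den_gt0 -1?ltnS //.
exact: (le_bigmax _ (fun i : 'I__ => bound_num N w p q i / bound_den m w i)).
Qed.
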